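(* Let $q$ be a prime power, let $m\le n$ and $\epsilon$ be positive integers with $m>2\epsilon$, and let $\mathbf{A}\in\mathbb{F}_q^{m\times n}$ with $\mathrm{rank}(\mathbf{A})=m$. Let $(\hat{K},n,\mathcal{X},\mathcal{A})$ be the functional index coding problem constructed from the $(\mathbf{A},\epsilon)$ function update problem. Let $\mathbf{H}\in\mathbb{F}_q^{l\times n}$ be a matrix such that $\mathbf{H}=\mathbf{S}\mathbf{A}$ for some $\mathbf{S}\in\mathbb{F}_q^{l\times m}$. Then $\mathbf{H}$ is a valid encoder matrix for the $(\mathbf{A},\epsilon)$ function update problem over $\mathbb{F}_q$ if and only if $\mathbf{H}$ is a valid encoder matrix for the $(\hat{K},n,\mathcal{X},\mathcal{A})$ functional index coding problem over $\mathbb{F}_q$.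
   Context: Vectors are column vectors, $\mathrm{wt}$ denotes Hamming weight, $[n]=\{1,\dots,n\}$, and for $X\subseteq[n]$, $\mathbf{x}_X$ denotes the subvector of $\mathbf{x}$ indexed by $X$. Function update: $\mathbf{H}\in\mathbb{F}_q^{l\times n}$ is a valid encoder matrix for the $(\mathbf{A},\epsilon)$ function update problem if there exists a function $\mathfrak{D}:\mathbb{F}_q^l\times\mathbb{F}_q^m\to\mathbb{F}_q^m$ such that $\mathfrak{D}(\mathbf{H}(\mathbf{x}+\mathbf{e}),\mathbf{A}\mathbf{x})=\mathbf{A}(\mathbf{x}+\mathbf{e})$ for all $\mathbf{x},\mathbf{e}\in\mathbb{F}_q^n$ with $\mathrm{wt}(\mathbf{e})\le\epsilon$. Functional index coding: a $(\hat{K},n,\mathcal{X},\mathcal{A})$ functional index coding problem consists of tuples $\mathcal{X}=(\mathcal{X}_1,\dots,\mathcal{X}_{\hat{K}})$ with $\mathcal{X}_i\subseteq[n]$ and $\mathcal{A}=(\mathbf{A}_1,\dots,\mathbf{A}_{\hat{K}})$ with $\mathbf{A}_i\in\mathbb{F}_q^{m\times n}$, $\mathrm{rank}(\mathbf{A}_i)=m$ (receiver $i$ knows $\mathbf{x}_{\mathcal{X}_i}$ and demands $\mathbf{A}_i\mathbf{x}$). A matrix $\mathbf{H}\in\mathbb{F}_q^{l\times n}$ is a valid encoder matrix for it if for each $i\in[\hat{K}]$ there is a function $\mathfrak{D}_i:\mathbb{F}_q^l\times\mathbb{F}_q^{|\mathcal{X}_i|}\to\mathbb{F}_q^m$ with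 $\mathfrak{D}_i(\mathbf{H}\mathbf{x},\mathbf{x}_{\mathcal{X}_i})=\mathbf{A}_i\mathbf{x}$ for all $\mathbf{x}\in\mathbb{F}_q^n$. Construction: given $(\mathbf{A},\epsilon)$, the constructed problem has one receiver for each subset $Q\subseteq[n]$ with $|Q|=\min(2\epsilon,n)=2\epsilon$ (so $\hat{K}=\binom{n}{2\epsilon}$); if $Q_1,\dots,Q_{\hat{K}}$ is an enumeration of these subsets, then $\mathcal{X}_j=[n]\setminus Q_j$ and $\mathbf{A}_j=\mathbf{A}$ for every $j\in[\hat{K}]$. *)

(* Defs.v *)
From mathcomp Require Import all_boot all_order all_algebra.

Set Implicit Arguments.
Unset Strict Implicit.
Unset Printing Implicit Defensive.

Import GRing.Theory.
Local Open Scope ring_scope.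

Definition wt (F : finFieldType) (n : nat) (x : 'cV[F]_n) : nat :=
  #|[set i : 'I_n | x i 0 != 0]|.

(* The coordinates of x indexed by X, listed in increasing order. *)
Definition subvec (F : finFieldType) (n : nat) (X : {set 'I_n})
    (x : 'cV[F]_n) : 'cV[F]_#|X| :=
  \col_(i < #|X|) x (enum_val i) 0.

Definition valid_update_encoder (F : finFieldType) (l m n : nat)
    (A : 'M[F]_(m, n)) (eps : nat) (H : 'M[F]_(l, n)) : Prop :=
  exists D : 'cV[F]_l * 'cV[F]_m -> 'cV[F]_m,
    forall x e : 'cV[F]_n, (wt e <= eps)%N ->
      D (H *m (x + e), A *m x) = A *m (x + e).

Record fic_problem (F : finFieldType) (m n : nat) := FICProblem {
  receivers : nat;
  side_info : receivers.-tuple {set 'I_n};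
  demand : receivers.-tuple 'M[F]_(m, n);
  rank_demand : forall i : 'I_receivers, \rank (tnth demand i) = m
}.

Definition valid_fic_encoder (F : finFieldType) (l m n : nat)
    (P : fic_problem F m n) (H : 'M[F]_(l, n)) : Prop :=
  forall i : 'I_(receivers P),
    exists D : 'cV[F]_l * 'cV[F]_#|tnth (side_info P) i| -> 'cV[F]_m,
      forall x : 'cV[F]_n,
        D (H *m x, subvec (tnth (side_info P) i) x) = tnth (demand P) i *m x.

Definition unknown_sets (n eps : nat) : {set {set 'I_n}} :=
  [set Q : {set 'I_n} | #|Q| == minn (2 * eps) n].

Definition enumerates (T : finType) (K : nat) (Q : K.-tuple T)
    (S : {set T}) : Prop :=
  uniq Q /\ Q =i S.

Lemma rank_const_demand (F : finFieldType) (m n K : nat) (A : 'M[F]_(m, n)) :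
  \rank A = m -> forall i : 'I_K, \rank (tnth [tuple A | _ < K] i) = m.
Proof. by move=> rA i; rewrite tnth_mktuple. Qed.

(* Q is meant to be an enumeration of unknown_sets n eps, where eps is the
   error bound of the function update problem; since the order of the
   receivers is arbitrary, it is left as a parameter. *)
Definition update_to_fic (F : finFieldType) (m n K : nat)
    (A : 'M[F]_(m, n)) (rankA : \rank A = m) (Q : K.-tuple {set 'I_n}) :
    fic_problem F m n :=
  @FICProblem F m n K [tuple ~: tnth Q j | j < K] [tuple A | _ < K]
    (rank_const_demand rankA).

(* Main.v *)
(* Since H = S A, the errors e, e' with the same transmitted symbol and the same
   A x differ by a vector d = e - e' with H d = 0, and d ranges over all vectors
   of weight at most 2 eps.  So H is a function update encoder iff H d = 0
   implies A d = 0 for every d of weight at most 2 eps.  Two messages that agree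
   outside Q differ by a vector supported in Q, so the index coding condition is
   the same implication for d supported in some Q with #|Q| = 2 eps, and every
   d of weight at most 2 eps is supported in such a Q. *)
Require Import Defs.
From mathcomp Require Import all_boot all_order all_algebra.

Set Implicit Arguments.
Unset Strict Implicit.
Unset Printing Implicit Defensive.

Import GRing.Theory.
Local Open Scope ring_scope.

(** A decoder can answer with [g] of any admissible preimage of the received word, which is
    unambiguous exactly when [f] determines [g] on [P]. The value [v0] serves words that no
    admissible input produces. *)
Lemma exists_decoder (T : finType) (U V : eqType) (v0 : V) (P : pred T)
    (f : T -> U) (g : T -> V) :
  (exists D : U -> V, forall a, P a -> D (f a) = g a) <->
  (forall a b, P a -> P b -> f a = f b -> g a = g b).
Proof.
split=> [[D DE] a b Pa Pb fab|fg]; first by rewrite -!DE // fab.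
exists (fun u => if [pick a | P a && (f a == u)] is Some a then g a else v0).
move=> a Pa; case: pickP => [b /andP[Pb /eqP fba]|/(_ a)]; first exact: fg.
by rewrite Pa eqxx.
Qed.

(** Elements of [B] are added to [A] one at a time. This serves both to cut a support in two and to
    enlarge one to a prescribed size. *)
Lemma exists_set_between (T : finType) (A B : {set T}) (k : nat) :
  A \subset B -> (#|A| <= k <= #|B|)%N ->
  exists C : {set T}, [/\ A \subset C, C \subset B & #|C| = k].
Proof.
move=> sAB; elim: k => [/andP[]|k IHk /andP[]].
  by rewrite leqn0 => /eqP A0 _; exists A.
rewrite leq_eqVlt => /orP[/eqP cardA _|leAk ltkB]; first by exists A.
have [|C [sAC sCB cardC]] := IHk; first by rewrite -ltnS leAk ltnW.
have [x xB xC] : exists2 x, x \in B & x \notin C.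
  by apply/subsetPn; apply: contraL ltkB => /subset_leq_card; rewrite cardC -leqNgt.
exists (x |: C); split; first exact: subset_trans sAC (subsetUr _ _).
  by rewrite subUset sub1set xB.
by rewrite cardsU1 xC cardC.
Qed.

Section Weight.
Variables (F : finFieldType) (n : nat).
Implicit Types (d e x : 'cV[F]_n) (X : {set 'I_n}).

Definition supp d : {set 'I_n} := [set i | d i 0 != 0].

Lemma supp_subP d X :
  reflect (forall i, i \notin X -> d i 0 = 0) (supp d \subset X).
Proof.
apply: (iffP subsetP) => [sdX i|dX i]; last first.
  by rewrite inE; apply: contraR => /dX ->.
by apply: contraNeq => di0; apply: sdX; rewrite inE.
Qed.

Lemma wt_le_card d X : supp d \subset X -> (wt d <= #|X|)%N.
Proof. exact: subset_leq_card. Qed.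

Lemma wt_sub d e : (wt (d - e) <= wt d + wt e)%N.
Proof.
apply: leq_trans (leq_card_setU (supp d) (supp e)); apply: wt_le_card.
apply/supp_subP => i; rewrite !inE negb_or !negbK => /andP[/eqP di /eqP ei].
by rewrite !mxE di ei subr0.
Qed.

(** Converse of [wt_sub]: up to [a] coordinates of the support go to [e], and the remaining ones,
    negated, to [e']. *)
Lemma wt_split d (a b : nat) : (wt d <= a + b)%N ->
  exists e e', [/\ d = e - e', (wt e <= a)%N & (wt e' <= b)%N].
Proof.
move=> wtd.
have [X [_ sXd cardX]] : exists X, [/\ set0 \subset X, X \subset supp d
    & #|X| = minn a (wt d)].
  by apply: exists_set_between; rewrite ?sub0set // cards0 geq_minr.
pose e := \col_i (if i \in X then d i 0 else 0).
pose e' := \col_i (if i \in X then 0 else - d i 0).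
exists e, e'; split.
- apply/matrixP=> i j; rewrite ord1 !mxE.
  by case: ifP => _; rewrite ?subr0 // opprK add0r.
- apply: (@leq_trans #|X|); last by rewrite cardX geq_minl.
  by apply: wt_le_card; apply/supp_subP => i /negPf iX; rewrite mxE iX.
- apply: (@leq_trans #|supp d :\: X|).
    apply: wt_le_card; apply/supp_subP => i.
    rewrite !inE negb_and !negbK mxE; case: ifP => //= _ /eqP ->.
    exact: oppr0.
  rewrite cardsD (setIidPr sXd) cardX /= leq_subLR -/(wt d).
  by case: (leqP a (wt d)) => // _; apply: leq_addr.
Qed.

Lemma eq_subvecP X x e :
  subvec X x = subvec X e <-> supp (x - e) \subset ~: X.
Proof.
split=> [xe|/supp_subP xe].
  apply/supp_subP => i; rewrite inE negbK => iX.
  move/colP/(_ (enum_rank_in iX i)): xe; rewrite !mxE enum_rankK_in // => ->.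
  exact: subrr.
apply/colP=> i; rewrite !mxE; apply/eqP; rewrite -subr_eq0; apply/eqP.
have := xe (enum_val i); rewrite !mxE; apply.
by rewrite inE negbK enum_valP.
Qed.

End Weight.

Lemma update_encoderP (F : finFieldType) (l m n eps : nat) (A : 'M[F]_(m, n))
    (S : 'M[F]_(l, m)) :
  valid_update_encoder A eps (S *m A) <->
  (forall d, (wt d <= 2 * eps)%N -> S *m A *m d = 0 -> A *m d = 0).
Proof.
split=> [[D DE] d wtd Hd|HA].
  move: wtd; rewrite mul2n -addnn => /wt_split[e [e' [dE wte wte']]].
  move/eqP: Hd; rewrite dE !mulmxBr subr_eq0 => /eqP He.
  (* For the message 0, the errors [e] and [e'] give the decoder the same input. *)
  have := DE 0 e wte; have := DE 0 e' wte'.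
  by rewrite !add0r He => -> ->; rewrite subrr.
have [] := exists_decoder (0 : 'cV[F]_m) (fun p => wt p.2 <= eps)%N
  (fun p : 'cV[F]_n * 'cV[F]_n => (S *m A *m (p.1 + p.2), A *m p.1))
  (fun p => A *m (p.1 + p.2)).
move=> _ /(_ _)[|D DE]; last by exists D => x e; apply: (DE (x, e)).
move=> [x e] [x' e'] /= wte wte' [+ Ax].
(* The factorization through [A] enters here: equal values of [A] on [x] and [x'] give equal
   encodings, which cancel and leave only the errors. *)
rewrite !mulmxDr -!(mulmxA S A x) -(mulmxA S A x') Ax => /addrI He.
congr (_ + _); apply/eqP; rewrite -subr_eq0 -mulmxBr; apply/eqP/HA.
  by rewrite mul2n -addnn; apply: leq_trans (wt_sub _ _) (leq_add wte wte').
by rewrite mulmxBr He subrr.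
Qed.

Lemma update_to_fic_encoderP (F : finFieldType) (l m n K : nat)
    (A : 'M[F]_(m, n)) (rankA : \rank A = m) (Q : K.-tuple {set 'I_n})
    (H : 'M[F]_(l, n)) :
  valid_fic_encoder (update_to_fic rankA Q) H <->
  (forall X, X \in Q -> forall d, supp d \subset X -> H *m d = 0 -> A *m d = 0).
Proof.
have decP (i : 'I_K) := exists_decoder (0 : 'cV[F]_m) predT
  (fun x => (H *m x, subvec (tnth [tuple ~: tnth Q j | j < K] i) x))
  (fun x => tnth [tuple A | _ < K] i *m x).
split=> [valH X /tnthP[i ->] d sdX Hd|HA i].
  have [D DE] := valH i; have [decE _] := decP i.
  (* By linearity it suffices to compare [d] with 0: receiver [i] cannot tell them apart. *)
  have := decE (ex_intro _ D (fun x _ => DE x)) d 0 isT isT.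
  rewrite !tnth_mktuple !mulmx0; apply; congr (_, _); first by rewrite Hd.
  by apply/eq_subvecP; rewrite setCK subr0.
have [_ /(_ _)[|D DE]] := decP i; last by exists D => x; apply: DE.
move=> x y _ _ [Hxy]; rewrite !tnth_mktuple => /eq_subvecP.
rewrite setCK => sxy; apply/eqP; rewrite -subr_eq0 -mulmxBr; apply/eqP.
by apply: HA (mem_tnth i Q) _ sxy _; rewrite mulmxBr Hxy subrr.
Qed.

Theorem theorem9 (F : finFieldType) (l m n eps : nat)
    (m_gt0 : (0 < m)%N) (n_gt0 : (0 < n)%N) (eps_gt0 : (0 < eps)%N)
    (le_mn : (m <= n)%N) (lt_2eps_m : (2 * eps < m)%N)
    (A : 'M[F]_(m, n)) (rankA : \rank A = m)
    (Q : 'C(n, 2 * eps).-tuple {set 'I_n})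
    (enumQ : enumerates Q (unknown_sets n eps))
    (H : 'M[F]_(l, n)) (HSA : exists S : 'M[F]_(l, m), H = S *m A) :
  valid_update_encoder A eps H <-> valid_fic_encoder (update_to_fic rankA Q) H.
Proof.
have [S ->] := HSA; have [_ memQ] := enumQ.
have le_2eps_n : (2 * eps <= n)%N := leq_trans (ltnW lt_2eps_m) le_mn.
have inQ X : (X \in Q) = (#|X| == 2 * eps)%N.
  by rewrite memQ inE (minn_idPl le_2eps_n).
apply: iff_trans; first exact: update_encoderP.
apply: iff_sym; apply: iff_trans; first exact: update_to_fic_encoderP.
split=> [HA d wtd|HA X + d sdX]; last first.
  by rewrite inQ => /eqP cardX; apply: HA; rewrite -cardX wt_le_card.
(* A receiver's unknown set has exactly [2 * eps] elements, so the support of [d] is padded to that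
   size, which [le_2eps_n] permits. *)
have [X [sdX _ cardX]] : exists X : {set 'I_n},
    [/\ supp d \subset X, X \subset setT
      & #|X| = (2 * eps)%N].
  by apply: exists_set_between; rewrite ?subsetT // cardsT card_ord wtd.
by apply: HA sdX; rewrite inQ cardX.
Qed.
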